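(* For every $n$ there exist a set $S$ of $n$ points in the plane and a family $\mathcal{F}$ of $\binom{n}{2}$ simply connected regions in the plane with linear union complexity such that the intersection hypergraph $\mathcal{I}(S,\mathcal{F})$ is the complete graph on $n$ vertices. More precisely, for every pair of points in $S$ there is a region in $\mathcal{F}$ that contains exactly these two points of $S$, every pair of regions of $\mathcal{F}$ intersects at most four times (that is, their boundaries intersect in at most four points), and for every $m$ the union complexity of any subfamily of $\mathcal{F}$ of size $m$ is at most $4m-4$.
   Context: A Jordan region is a (simply connected) closed bounded region in the plane whose boundary is a closed simple Jordan curve. For a finite set $S$ of points and a family $\mathcal{F}$ of regions, the intersection hypergraph $\mathcal{I}(S,\mathcal{F})$ is the simple hypergraph (no multiple edges) that has a vertex $v_p$ for every $p\in S$ and, for every $F\in\mathcal{F}$, the hyperedge $\{v_p : p\in S\cap F\}$ whenever this set has size at least two. For a finite family $\mathcal{G}$ of Jordan regions whose boundaries intersect in finitely many points, the vertices of the arrangement of $\mathcal{G}$ are the intersection points of the boundaries of regions in $\mathcal{G}$, and the edges are the maximal connected parts of the boundaries of regions in $\mathcal{G}$ that do not contain a vertex. The union complexity of $\mathcal{G}$ is the number of edges of the arrangement of $\mathcal{G}$ that lie on the boundary of $\bigcup_{G\in\mathcal{G}}G$. A family $\mathcal{G}$ has linear union complexity if there exists a constant $c$ such that for any subfamily $\mathcal{G}'$ of $\mathcal{G}$ the union complexity of $\mathcal{G}'$ is at most $c|\mathcal{G}'|$.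
   Formalization: The bound 4m-4 on the union complexity of subfamilies of size m is stated only for m ≥ 2: for m = 1 it fails, since a single Jordan region has its whole boundary as one edge (union complexity 1 > 0), and for m = 0 it would be negative. *)

(* Defs.v *)
From mathcomp Require Export all_boot all_order all_algebra.
From mathcomp Require Export all_classical all_reals all_analysis.
Export numFieldNormedType.Exports.

Set Implicit Arguments.
Unset Strict Implicit.
Unset Printing Implicit Defensive.

Import Order.TTheory GRing.Theory Num.Theory.

Local Open Scope classical_set_scope.
Local Open Scope card_scope.
Local Open Scope ring_scope.

Notation plane R := (R * R)%type.

Definition boundary (T : topologicalType) (A : set T) : set T :=
  closure A `\` interior A.

Definition path_in (R : realType) (T : topologicalType) (A : set T)
    (g : R -> T) : Prop :=
  {within `[0, 1], continuous g} /\ g @` `[0, 1] `<=` A.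

Definition path_connected (R : realType) (T : topologicalType)
    (A : set T) : Prop :=
  A !=set0 /\
  forall x y, A x -> A y ->
    exists g : R -> T, [/\ path_in A g, g 0 = x & g 1 = y].

(* [H (s, t)]: time [s] of the contraction, parameter [t] along the loop.     *)
Definition contractible_loop (R : realType) (T : topologicalType)
    (A : set T) (g : R -> T) : Prop :=
  exists (H : R * R -> T) (c : T),
    [/\ {within `[0, 1]%classic `*` `[0, 1]%classic, continuous H},
        H @` (`[0, 1]%classic `*` `[0, 1]%classic) `<=` A,
        forall t, t \in `[0, 1]%R -> H (0, t) = g t,
        forall t, t \in `[0, 1]%R -> H (1, t) = c &
        forall s, s \in `[0, 1]%R -> H (s, 0) = H (s, 1)].

Definition simply_connected (R : realType) (T : topologicalType)
    (A : set T) : Prop :=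
  path_connected R A /\
  forall g : R -> T, path_in A g -> g 0 = g 1 -> contractible_loop A g.

Definition Jordan_curve (R : realType) (J : set (plane R)) : Prop :=
  exists g : R -> plane R,
    [/\ {within `[0, 1], continuous g}, g 0 = g 1,
        {in `[0, 1[%R &, injective g} & J = g @` `[0, 1]].

(* Simple connectedness rules out the Jordan curve itself, a closed bounded
   set which is its own boundary.                                             *)
Definition Jordan_region (R : realType) (A : set (plane R)) : Prop :=
  [/\ closed A, bounded_set A, simply_connected R A &
      Jordan_curve (boundary A)].

(* Vertices [v_p] are identified with the points [p]; having [hyperedges] be
   a set of sets makes the hypergraph simple.                                 *)
Record hypergraph (T : Type) := Hypergraph {
  vertices : set T;
  hyperedges : set (set T)
}.

Definition intersection_hypergraph (T : Type) (S : set T)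
    (F : set (set T)) : hypergraph T :=
  Hypergraph S [set e | (exists2 A, F A & e = S `&` A) /\ `I_2 #<= e].

Definition is_complete_graph (T : Type) (n : nat) (H : hypergraph T) : Prop :=
  vertices H #= `I_n /\
  hyperedges H = [set e | e `<=` vertices H /\ e #= `I_2].

Definition arrangement_vertices (T : topologicalType)
    (G : set (set T)) : set T :=
  [set x | exists A B, [/\ G A, G B, A <> B & (boundary A `&` boundary B) x]].

(* A boundary that carries no vertex is itself a single (closed) edge.        *)
Definition arrangement_edges (T : topologicalType)
    (G : set (set T)) : set (set T) :=
  [set E | exists A x,
     [/\ G A, (boundary A `\` arrangement_vertices G) x &
         E = connected_component (boundary A `\` arrangement_vertices G) x]].

Definition union_edges (T : topologicalType) (G : set (set T)) : set (set T) :=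
  [set E | arrangement_edges G E /\ E `<=` boundary (\bigcup_(A in G) A)].

(* The union complexity of [G] is the cardinality of [union_edges G]; as a
   statement about cardinals, the bound below includes finiteness.            *)
Definition union_complexity_le (T : topologicalType) (G : set (set T))
    (k : nat) : Prop :=
  union_edges G #<= `I_k.

Definition linear_union_complexity (T : topologicalType)
    (F : set (set T)) : Prop :=
  exists c : nat, forall (m : nat) (G : set (set T)),
    G `<=` F -> G #= `I_m -> union_complexity_le G (c * m).

(* Main.v *)
Require Import Defs.
From mathcomp Require Import zify ring lra.

Set Implicit Arguments.
Unset Strict Implicit.
Unset Printing Implicit Defensive.

Import Order.TTheory GRing.Theory Num.Theory.

Local Open Scope ring_scope.
Local Open Scope classical_set_scope.
Local Open Scope card_scope.

(** The points are p_i = (2i, r + 1/2 - 2i) with r = 2n + 2, and the region of a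
    pair P is the diamond |x| + |y| <= c_P carrying a unit spike over x = 2i for
    each i in P.  The radii c_P are distinct and lie in ]r, r + 1/3], so that the
    spike over 2i covers p_i while the bare diamonds miss it.  Where two regions
    carry the same spike one lies above the other, so their boundaries meet only
    where a spike of the smaller diamond sticks out of the larger region: at most
    two spikes, two points each.  In the union of m regions, the region M with
    the largest diamond is interrupted only by spikes of the m - 1 other regions.
    Every edge of the union is the peak of one of these at most 2(m - 1) spikes,
    or the part of the boundary of M that follows it to the right (cyclically),
    which gives the bound 4(m - 1). *)

(** * Diamonds with a bumpy upper side *)

Definition cap (R : realType) (c : R) (s : R -> R) : set (plane R) :=
  [set z | `|z.1| - c <= z.2 /\ z.2 <= c - `|z.1| + s z.1].

(** The upper bound makes [s] vanish for |x| >= c, so that the two sides of the cap still meet at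
    (-c, 0) and (c, 0); elsewhere it at most doubles the height of the upper side. *)
Definition bump (R : realType) (c : R) (s : R -> R) : Prop :=
  continuous s /\ forall x, 0 <= s x <= Num.max 0 (c - `|x|).

Lemma bump_ge0 (R : realType) (c : R) (s : R -> R) x : bump c s -> 0 <= s x.
Proof. by case=> _ /(_ x) /andP[]. Qed.

Lemma bump_eq0 (R : realType) (c : R) (s : R -> R) x :
  bump c s -> c <= `|x| -> s x = 0.
Proof.
case=> _ /(_ x) + cx; rewrite max_l ?subr_le0// => /andP[s0 s1].
by apply/eqP; rewrite eq_le s0 s1.
Qed.

Lemma cap_norm_le (R : realType) (c : R) (s : R -> R) z :
  bump c s -> cap c s z -> `|z.1| <= c.
Proof.
move=> sb [/= z1 z2]; rewrite leNgt; apply/negP => cz.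
by have := bump_eq0 sb (ltW cz); lra.
Qed.

Lemma upper_gap_continuous (R : realType) (c : R) (s : R -> R) :
  continuous s ->
  continuous (fun z : plane R => c - `|z.1| + s z.1 - z.2).
Proof.
move=> sc z; apply: cvgB; last exact: cvg_snd.
apply: cvgD; first by apply: cvgB; [exact: cvg_cst|apply: cvg_norm; exact: cvg_fst].
by apply: (@cvg_comp _ _ _ fst s _ (nbhs z.1)); [exact: cvg_fst|exact: sc].
Qed.

Lemma lower_gap_continuous (R : realType) (c : R) :
  continuous (fun z : plane R => z.2 - (`|z.1| - c)).
Proof.
move=> z; apply: cvgB; first exact: cvg_snd.
by apply: cvgB; [apply: cvg_norm; exact: cvg_fst|exact: cvg_cst].
Qed.

Lemma closed_cap (R : realType) (c : R) (s : R -> R) :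
  bump c s -> closed (cap c s).
Proof.
case=> sc _.
rewrite (_ : cap c s =
  (fun z : plane R => z.2 - (`|z.1| - c)) @^-1` [set y | 0 <= y] `&`
  (fun z : plane R => c - `|z.1| + s z.1 - z.2) @^-1` [set y | 0 <= y]).
  apply: closedI; (apply: preimage_closed; [move=> z _|exact: closed_ge]).
  - exact: lower_gap_continuous.
  - exact: upper_gap_continuous.
by apply/seteqP; split=> z /= []; rewrite !subr_ge0.
Qed.

(** An interior point can be moved slightly up and down inside the cap, which makes both
    inequalities strict. Conversely, the strict inequalities define an open set. *)
Lemma interior_cap (R : realType) (c : R) (s : R -> R) : bump c s ->
  (cap c s)° = [set z | `|z.1| - c < z.2 /\ z.2 < c - `|z.1| + s z.1].
Proof.
move=> [sc sb]; apply/seteqP; split=> [[x y] cz|].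
  have [_ _] := interior_subset cz.
  suff [e e0 ce] : exists2 e : R, 0 < e & forall d, `|d| < e -> cap c s (x, y + d).
    have e2 : `|e / 2| < e by rewrite ger0_norm; lra.
    have e2' : `|- (e / 2)| < e by rewrite normrN.
    by have [/= ? ?] := ce _ e2; have [/= ? ?] := ce _ e2'; split => /=; lra.
  have : \forall d \near (0 : R), cap c s (x, y + d).
    have dc : (fun d : R => (x, y + d)) @ nbhs (0 : R) --> (x, y).
      apply: (@cvg_pair _ _ _ (nbhs (0 : R)) (nbhs x) (nbhs y)).
        exact: cvg_cst.
      have : y + d @[d --> (0 : R)] --> y + 0.
        by apply: cvgD; [exact: cvg_cst|exact: cvg_id].
      by rewrite addr0.
    exact: (dc _ cz).
  case/nbhs_norm0P => e /= e0 ce; exists e => // d de; exact: ce.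
rewrite (_ : [set z | _] =
  (fun z : plane R => z.2 - (`|z.1| - c)) @^-1` [set y | 0 < y] `&`
  (fun z : plane R => c - `|z.1| + s z.1 - z.2) @^-1` [set y | 0 < y]).
  rewrite -open_subsetE.
    by move=> z /= []; rewrite !subr_gt0 => z1 z2; split; exact: ltW.
  apply: openI; (apply: open_comp; [move=> z _|exact: open_gt]).
  - exact: lower_gap_continuous.
  - exact: upper_gap_continuous.
by apply/seteqP; split=> z /= []; rewrite !subr_gt0.
Qed.

Lemma boundary_cap (R : realType) (c : R) (s : R -> R) : bump c s ->
  boundary (cap c s) = [set z | `|z.1| <= c /\
    (z.2 = c - `|z.1| + s z.1 \/ z.2 = `|z.1| - c)].
Proof.
move=> sb; rewrite /boundary (interior_cap sb) -((closure_id _).1 (closed_cap sb)).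
apply/seteqP; split=> z /=.
  move=> [cz nz]; split; first exact: cap_norm_le cz.
  case: cz => /=; rewrite le_eqVlt => /orP[/eqP<-|z1]; first by right.
  rewrite le_eqVlt => /orP[/eqP<-|z2]; first by left.
  by case: nz.
have s0 := bump_ge0 z.1 sb.
move=> [zc [zE|zE]]; (split; [split=> /=; lra|case; lra]).
Qed.

Lemma bounded_cap (R : realType) (c : R) (s : R -> R) :
  bump c s -> bounded_set (cap c s).
Proof.
(* The plane carries the max norm, and the upper side has height at most 2 (c - |x|). *)
move=> sb; exists (2 * c); split; first exact: num_real.
move=> M cM [x y] cz; have /= xc := cap_norm_le sb cz.
have [_ /(_ x)/andP[_]] := sb; rewrite max_r ?subr_ge0// => sx.
case: cz => /= z1 z2.
have x0 := normr_ge0 x.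
by rewrite [`|_|]prod_normE/= ge_max; apply/andP; split; [|rewrite ler_norml]; lra.
Qed.

(* First flattens onto the x-axis, then slides along it to the origin. *)
Definition fold_in (R : realType) (s : R) (z : plane R) : plane R :=
  (Num.min 1 (2 - 2 * s) * z.1, Num.max 0 (1 - 2 * s) * z.2).

Lemma fold_in0 (R : realType) (z : plane R) : fold_in 0 z = z.
Proof.
by case: z => x y; rewrite /fold_in min_l ?max_r /=; [congr (_, _)|..]; lra.
Qed.

Lemma fold_in1 (R : realType) (z : plane R) : fold_in 1 z = 0.
Proof.
by case: z => x y; rewrite /fold_in min_r ?max_l /=; [congr (_, _)|..]; lra.
Qed.

Lemma fold_in_continuous (R : realType) :
  continuous (fun p : R * plane R => fold_in p.1 p.2).
Proof.
move=> p.
have c1 : (fun p : R * plane R => Num.min 1 (2 - 2 * p.1)) @ p -->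
    (Num.min 1 (2 - 2 * p.1)).
  apply: (@continuous_min R _ (fun=> 1) (fun p : R * plane R => 2 - 2 * p.1)).
    exact: cvg_cst.
  by apply: cvgB; [exact: cvg_cst|apply: cvgM; [exact: cvg_cst|exact: cvg_fst]].
have c2 : (fun p : R * plane R => Num.max 0 (1 - 2 * p.1)) @ p -->
    (Num.max 0 (1 - 2 * p.1)).
  apply: (@continuous_max R _ (fun=> 0) (fun p : R * plane R => 1 - 2 * p.1)).
    exact: cvg_cst.
  by apply: cvgB; [exact: cvg_cst|apply: cvgM; [exact: cvg_cst|exact: cvg_fst]].
apply: (@cvg_pair _ _ _ (nbhs p)
  (nbhs (Num.min 1 (2 - 2 * p.1) * p.2.1))
  (nbhs (Num.max 0 (1 - 2 * p.1) * p.2.2))).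
  apply: cvgM => //; apply: (@cvg_comp _ _ _ snd fst _ (nbhs p.2)).
    exact: cvg_snd.
  exact: cvg_fst.
apply: cvgM => //; apply: (@cvg_comp _ _ _ snd snd _ (nbhs p.2)); exact: cvg_snd.
Qed.

Lemma cvg_fold_in (R : realType) (T : Type) (F : set_system T) (FF : Filter F)
    (f : T -> R) (g : T -> plane R) (s : R) (z : plane R) :
  f @ F --> s -> g @ F --> z -> (fun t => fold_in (f t) (g t)) @ F --> fold_in s z.
Proof.
move=> fs gz; apply: (@cvg_comp _ _ _ (fun t => (f t, g t))
  (fun p : R * plane R => fold_in p.1 p.2) F (nbhs (s, z))).
  exact: (@cvg_pair _ _ _ F (nbhs s) (nbhs z)).
exact: (@fold_in_continuous R (s, z)).
Qed.

(** The closure properties that the two phases of [fold_in] need: up to time 1/2 only the second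
    coordinate shrinks, and from then on it is 0 and the first one shrinks. *)
Definition foldable (R : realType) (A : set (plane R)) : Prop :=
  forall (x y l : R), A (x, y) -> 0 <= l <= 1 -> A (x, l * y) /\ A (l * x, 0).

Lemma foldable_fold_in (R : realType) (A : set (plane R)) (s : R) z :
  foldable A -> 0 <= s <= 1 -> A z -> A (fold_in s z).
Proof.
case: z => x y Af s01 Az; rewrite /fold_in/=.
have [s2|s2] := leP s (1 / 2).
  rewrite min_l ?max_r ?mul1r; [|lra..].
  by apply: (Af x y _ Az _).1; lra.
rewrite min_r ?max_l ?mul0r; [|lra..].
by apply: (Af x y _ Az _).2; lra.
Qed.

(** Fold [z] into the origin, then unfold [w] out of it. The two motions can simply be added,
    because at every time one of them rests at 0. *)
Lemma foldable_path_connected (R : realType) (A : set (plane R)) :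
  A !=set0 -> foldable A -> path_connected R A.
Proof.
move=> A0 Af; split=> // z w Az Aw.
exists (fun t => fold_in (Num.min 1 (2 * t)) z + fold_in (Num.min 1 (2 - 2 * t)) w).
split; last 2 first.
- by rewrite mulr0 subr0 min_r ?fold_in0 ?min_l ?fold_in1 ?addr0 //; lra.
- by rewrite mulr1 subrr min_l ?fold_in1 ?min_r ?fold_in0 ?add0r //; lra.
split.
  apply: continuous_subspaceT => t.
  apply: cvgD; apply: cvg_fold_in; try exact: cvg_cst.
    apply: (@continuous_min R _ (fun=> 1) (fun t : R => 2 * t)).
      exact: cvg_cst.
    by apply: cvgM; [exact: cvg_cst|exact: cvg_id].
  apply: (@continuous_min R _ (fun=> 1) (fun t : R => 2 - 2 * t)).
    exact: cvg_cst.
  apply: cvgB; first exact: cvg_cst.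
  by apply: cvgM; [exact: cvg_cst|exact: cvg_id].
move=> _ /= [t + <-]; rewrite in_itv/= => t01.
have [t2|t2] := leP t (1 / 2).
  rewrite [in X in _ + X]min_l ?fold_in1 ?addr0; last lra.
  by apply: foldable_fold_in => //; rewrite min_r; lra.
rewrite [in X in X + _]min_l ?fold_in1 ?add0r; last lra.
by apply: foldable_fold_in => //; rewrite min_r; lra.
Qed.

Lemma foldable_simply_connected (R : realType) (A : set (plane R)) :
  A !=set0 -> foldable A -> simply_connected R A.
Proof.
move=> A0 Af; split; first exact: foldable_path_connected.
move=> g [/subspace_continuousP gc gA] g01.
exists (fun p : R * R => fold_in p.1 (g p.2)), 0; split.
- apply/subspace_continuousP => -[s t] [/= s01 t01].
  apply: cvg_fold_in.
    apply: cvg_within_filter.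
    exact: (@cvg_fst _ _ (nbhs s) (nbhs t)).
  (* [g] is continuous only within [0, 1], so the second projection must be shown to converge within
     that interval. *)
  have It : snd @ within (`[0, 1]%classic `*` `[0, 1]%classic) (nbhs (s, t)) -->
      within `[0, 1] (nbhs t).
    move=> B /= tB.
    have := @cvg_snd _ _ (nbhs s) (nbhs t) _ _ tB.
    rewrite /within/= !nbhs_simpl/= => sB; apply: filterS (sB _) => p pB [? ?].
    exact: pB.
  exact: (cvg_comp _ _ It (gc t t01)).
- move=> _ [[s t] [/= s01 t01] <-]; apply: foldable_fold_in => //.
  by apply: gA; exists t.
- by move=> t _; exact: fold_in0.
- by move=> t _; exact: fold_in1.
- by move=> s _ /=; rewrite g01.
Qed.

(** Since |x| <= c and [s] is nonnegative, each vertical section is an interval containing 0, and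
    the cap contains the segment of the x-axis from -c to c. *)
Lemma foldable_cap (R : realType) (c : R) (s : R -> R) :
  bump c s -> foldable (cap c s).
Proof.
move=> sb x y l cz /andP[l0 l1].
have /= xc := cap_norm_le sb cz; case: cz => /= z1 z2.
have sx := bump_ge0 x sb; have slx := bump_ge0 (l * x) sb.
split; split=> /=; [nra|nra| |]; rewrite normrM (ger0_norm l0).
all: have := normr_ge0 x; nra.
Qed.

Lemma cap0 (R : realType) (c : R) (s : R -> R) :
  bump c s -> 0 <= c -> cap c s 0.
Proof.
by move=> sb c0; have := bump_ge0 0 sb; split; rewrite /= normr0; lra.
Qed.

(* The image of a parametrized diamond under the shear
   (x, y) |-> (x, y + min (s x) (max 0 y)), which, for a bump s, raises the upper
   side by s and fixes the lower side. *)
Definition cap_loop (R : realType) (c : R) (s : R -> R) (t : R) : plane R :=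
  let x := c * (1 - `|4 * t - 2|) in
  let y := c * (Num.max 0 (1 - `|4 * t - 1|) - Num.max 0 (1 - `|4 * t - 3|)) in
  (x, y + Num.min (s x) (Num.max 0 y)).

(** The first half of the loop follows the upper side from left to right. The unsheared height there
    is c - |x|, so the bound in [bump] makes the minimum equal to [s x]. *)
Lemma cap_loop_upper (R : realType) (c : R) (s : R -> R) t :
  bump c s -> 0 < c -> 0 <= t <= 1 / 2 ->
  let x := c * (4 * t - 1) in cap_loop c s t = (x, c - `|x| + s x).
Proof.
move=> [_ sb] c0 t01 x; rewrite /cap_loop.
have t1 : `|4 * t - 1| <= 1 by rewrite ler_norml; lra.
rewrite (ler0_norm (_ : 4 * t - 2 <= 0)); last lra.
rewrite (ler0_norm (_ : 4 * t - 3 <= 0)); last lra.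
rewrite [Num.max 0 (1 - - _)]max_l; last lra.
rewrite [Num.max 0 (1 - _)]max_r ?subr0; last lra.
have -> : c * (1 - - (4 * t - 2)) = x by rewrite /x; lra.
have -> : c * (1 - `|4 * t - 1|) = c - `|x|.
  by rewrite /x normrM (gtr0_norm c0); lra.
by rewrite min_l//; case/andP: (sb x).
Qed.

Lemma cap_loop_lower (R : realType) (c : R) (s : R -> R) t :
  bump c s -> 0 < c -> 1 / 2 <= t <= 1 ->
  let x := c * (3 - 4 * t) in cap_loop c s t = (x, `|x| - c).
Proof.
move=> sb c0 t01 x; rewrite /cap_loop.
have t1 : `|4 * t - 3| <= 1 by rewrite ler_norml; lra.
rewrite (ger0_norm (_ : 0 <= 4 * t - 2)); last lra.
rewrite (ger0_norm (_ : 0 <= 4 * t - 1)); last lra.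
rewrite [Num.max 0 (1 - (4 * t - 1))]max_l; last lra.
rewrite [Num.max 0 (1 - `|_|)]max_r ?sub0r; last lra.
have -> : c * (1 - (4 * t - 2)) = x by rewrite /x; lra.
have -> : c * - (1 - `|4 * t - 3|) = `|x| - c.
  by rewrite /x normrM (gtr0_norm c0) (distrC 3); ring.
have xc : `|x| <= c.
  rewrite /x normrM (gtr0_norm c0); apply: ler_piMr; first exact: ltW.
  by rewrite distrC.
rewrite [Num.max _ _]max_l ?subr_le0// min_r ?addr0//; exact: bump_ge0 sb.
Qed.

Lemma cap_loop_continuous (R : realType) (c : R) (s : R -> R) :
  continuous s -> continuous (cap_loop c s).
Proof.
move=> sc.
have cn (b : R) : continuous (fun t : R => `|4 * t - b|).
  move=> t; apply: cvg_norm; apply: cvgB; last exact: cvg_cst.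
  by apply: cvgM; [exact: cvg_cst|exact: cvg_id].
have cm (b : R) : continuous (fun t : R => Num.max 0 (1 - `|4 * t - b|)).
  move=> t; apply: (@continuous_max R _ (fun=> 0) (fun t : R => 1 - `|4 * t - b|)).
    exact: cvg_cst.
  by apply: cvgB; [exact: cvg_cst|exact: cn].
pose x (t : R) := c * (1 - `|4 * t - 2|).
have cx : continuous x.
  move=> t; apply: cvgM; first exact: cvg_cst.
  by apply: cvgB; [exact: cvg_cst|exact: cn].
pose y (t : R) := c * (Num.max 0 (1 - `|4 * t - 1|) - Num.max 0 (1 - `|4 * t - 3|)).
have cy : continuous y.
  by move=> t; apply: cvgM; [exact: cvg_cst|apply: cvgB; exact: cm].
move=> t.
apply: (@cvg_pair _ _ _ (nbhs t) (nbhs (x t))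
  (nbhs (y t + Num.min (s (x t)) (Num.max 0 (y t))))); first exact: cx.
apply: cvgD; first exact: cy.
apply: (@continuous_min R _ (s \o x) (fun t : R => Num.max 0 (y t))).
  by apply: continuous_comp; [exact: cx|exact: sc].
apply: (@continuous_max R _ (fun=> 0) y); [exact: cvg_cst|exact: cy].
Qed.

Lemma cap_loop_inj (R : realType) (c : R) (s : R -> R) :
  bump c s -> 0 < c -> {in `[0, 1[%R &, injective (cap_loop c s)}.
Proof.
move=> sb c0; have cI := mulfI (lt0r_neq0 c0).
(* The two sides meet only where |x| = c, that is at u = 1/2 and u = 1, which the strict bounds on
   [u] exclude. *)
have mixed t u : 0 <= t <= 1 / 2 -> 1 / 2 < u < 1 ->
    cap_loop c s t = cap_loop c s u -> False.
  move=> t01 u01; rewrite cap_loop_upper// cap_loop_lower//; last lra.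
  case=> /cI tu; rewrite -tu.
  have := bump_ge0 (c * (4 * t - 1)) sb.
  have [t0|t0] := leP 0 (4 * t - 1).
    by rewrite ger0_norm; nra.
  by rewrite ltr0_norm; nra.
move=> /= t u; rewrite !in_itv/= => t01 u01.
have [t2|t2] := leP t (1 / 2); have [u2|u2] := leP u (1 / 2).
- by rewrite !cap_loop_upper//; [case=> /cI; lra|lra..].
- by move=> e; case: (@mixed t u _ _ e); lra.
- by move=> /esym e; case: (@mixed u t _ _ e); lra.
- by rewrite !cap_loop_lower//; [case=> /cI; lra|lra..].
Qed.

Lemma cap_loop_image (R : realType) (c : R) (s : R -> R) :
  bump c s -> 0 < c -> cap_loop c s @` `[0, 1] = boundary (cap c s).
Proof.
move=> sb c0; rewrite boundary_cap//; apply/seteqP; split.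
  move=> _ [t ti <-].
  have {ti} t01 : 0 <= t <= 1 by move: ti; rewrite /= in_itv.
  have [t2|t2] := leP t (1 / 2).
    rewrite cap_loop_upper//=; last lra.
    split; last by left.
    by rewrite normrM (gtr0_norm c0) ler_piMr ?ler_norml; lra.
  rewrite cap_loop_lower//=; last lra.
  split; last by right.
  by rewrite normrM (gtr0_norm c0) ler_piMr ?ler_norml; lra.
move=> [x y] [/= + yE]; rewrite ler_norml => /andP[x1 x2].
have xc : -1 <= x / c <= 1 by rewrite ler_pdivlMr// ler_pdivrMr//; lra.
have cK : c * (x / c) = x by rewrite mulrC divfK// gt_eqF.
case: yE => yE.
  exists ((x / c + 1) / 4); first by rewrite /= in_itv/=; lra.
  rewrite cap_loop_upper//; last lra.
  have -> : 4 * ((x / c + 1) / 4) - 1 = x / c by lra.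
  by rewrite cK yE.
exists ((3 - x / c) / 4); first by rewrite /= in_itv/=; lra.
rewrite cap_loop_lower//; last lra.
have -> : 3 - 4 * ((3 - x / c) / 4) = x / c by lra.
by rewrite cK yE.
Qed.

Lemma Jordan_region_cap (R : realType) (c : R) (s : R -> R) :
  bump c s -> 0 < c -> Jordan_region (cap c s).
Proof.
move=> sb c0; split.
- exact: closed_cap.
- exact: bounded_cap.
- apply: foldable_simply_connected; last exact: foldable_cap.
  by exists 0; apply: cap0 => //; exact: ltW.
- exists (cap_loop c s); split.
  + by apply: continuous_subspaceT; apply: cap_loop_continuous; case: sb.
  + rewrite cap_loop_upper//; last lra.
    rewrite cap_loop_lower//; last lra.
    have c1 : `|c| <= `|- c| by rewrite normrN.
    rewrite mulr0 sub0r mulrN1 mulr1 (_ : 3 - 4 = -1) ?mulrN1; last lra.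
    by rewrite (bump_eq0 sb) ?normrN ?gtr0_norm// subrr addr0.
  + exact: cap_loop_inj.
  + by rewrite cap_loop_image.
Qed.

(** Serves the families of at most one region, where a whole boundary is a single edge. *)
Lemma connected_boundary_cap (R : realType) (c : R) (s : R -> R) :
  bump c s -> 0 < c -> connected (boundary (cap c s)).
Proof.
move=> sb c0; rewrite -cap_loop_image//.
apply: connected_continuous_connected; first exact: segment_connected.
by apply: continuous_subspaceT; apply: cap_loop_continuous; case: sb.
Qed.

(** * The regions of the construction *)

Definition tent (R : realType) (i : nat) (x : R) : R :=
  Num.max 0 (1 - `|x - 2 * i%:R|).

(** Tents have half-width 1 and centres at least 2 apart, so at most one summand is nonzero at each
    [x]. *)
Definition spikes (R : realType) (n : nat) (P : {set 'I_n}) (x : R) : R :=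
  \sum_(i in P) tent i x.

Lemma tent_ge0 (R : realType) i (x : R) : 0 <= tent i x.
Proof. by rewrite le_max lexx. Qed.

Lemma tent_gt0 (R : realType) i (x : R) :
  (0 < tent i x) = (`|x - 2 * i%:R| < 1).
Proof. by rewrite lt_max ltxx /= subr_gt0. Qed.

Lemma tent_eq (R : realType) i (x d : R) : 0 < d -> tent i x = d ->
  x = 2 * i%:R + (1 - d) \/ x = 2 * i%:R - (1 - d).
Proof.
move=> d0; rewrite /tent; have [/ltW|_] := ltP 0 (1 - `|x - 2 * i%:R|).
  by case: (leP 0 (x - 2 * i%:R)) => [/ger0_norm->|/ltr0_norm->]; lra.
lra.
Qed.

Lemma tent_mono (R : realType) i (x y : R) :
  `|y - 2 * i%:R| <= `|x - 2 * i%:R| -> tent i x <= tent i y.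
Proof.
move=> yx; rewrite {1}/tent ge_max tent_ge0 /= le_max.
by apply/orP; right; lra.
Qed.

Lemma tent_eq0 (R : realType) i (x : R) : 1 <= `|x - 2 * i%:R| -> tent i x = 0.
Proof. by move=> ix; rewrite /tent max_l //; lra. Qed.

Lemma tent_continuous (R : realType) i : continuous (@tent R i).
Proof.
move=> x; apply: (@continuous_max R _ (fun=> 0) (fun x : R => 1 - `|x - 2 * i%:R|)).
  exact: cvg_cst.
apply: cvgB; first exact: cvg_cst.
by apply: cvg_norm; apply: cvgB; [exact: cvg_id|exact: cvg_cst].
Qed.

Lemma tent_disjoint (R : realType) i j (x : R) :
  0 < tent i x -> 0 < tent j x -> i = j.
Proof.
rewrite !tent_gt0 !ltr_norml => ix jx.
have ij : (i < j.+1)%N by rewrite -(ltr_nat R) -natr1; lra.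
have ji : (j < i.+1)%N by rewrite -(ltr_nat R) -natr1; lra.
by apply/eqP; rewrite eqn_leq -ltnS ij -ltnS ji.
Qed.

Lemma spikesE (R : realType) n (P : {set 'I_n}) (i : 'I_n) (x : R) :
  0 < tent i x -> spikes P x = (i \in P)%:R * tent i x.
Proof.
move=> ix; have other j : j != i -> tent j x = 0.
  move=> ji; apply/eqP; rewrite eq_le tent_ge0 andbT leNgt.
  by apply: contra ji => jx; apply/eqP/val_inj/(tent_disjoint jx ix).
rewrite /spikes; have [iP|iP] := boolP (i \in P).
  rewrite (bigD1 i)//= big1 ?addr0 ?mul1r// => j /andP[_ ji]; exact: other.
rewrite mul0r big1// => j jP; apply: other.
by apply: contraNneq iP => <-.
Qed.

Lemma spikes_ge0 (R : realType) n (P : {set 'I_n}) (x : R) : 0 <= spikes P x.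
Proof. by apply: sumr_ge0 => i _; exact: tent_ge0. Qed.

Lemma spikes_gt0 (R : realType) n (P : {set 'I_n}) (x : R) :
  0 < spikes P x -> exists2 i, i \in P & 0 < tent i x.
Proof.
move=> s0; have [/exists_inP[i iP ix]|] := boolP [exists i in P, 0 < tent i x].
  by exists i.
rewrite negb_exists_in => /forall_inP ni; move: s0; rewrite /spikes big1 ?ltxx//.
by move=> i /ni; rewrite -leNgt => ix; apply/eqP; rewrite eq_le ix tent_ge0.
Qed.

Lemma spikesB (R : realType) n (P Q : {set 'I_n}) (i : 'I_n) (x : R) :
  i \in P -> i \notin Q -> 0 < tent i x -> spikes P x - spikes Q x = tent i x.
Proof.
by move=> iP iQ ix; rewrite !(spikesE _ ix) iP (negPf iQ) mul1r mul0r subr0.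
Qed.

(** Spikes have the same shape in every region, so a common spike cancels and only one that [Q]
    lacks can make the difference positive. *)
Lemma spikesB_gt0 (R : realType) n (P Q : {set 'I_n}) (x : R) :
  spikes Q x < spikes P x ->
  exists i : 'I_n, [/\ i \in P, i \notin Q & 0 < tent i x].
Proof.
move=> QP; have [|i iP ix] := @spikes_gt0 R n P x.
  by apply: le_lt_trans QP; exact: spikes_ge0.
exists i; split=> //; apply: contraTN QP => iQ.
by rewrite !(spikesE _ ix) iP iQ ltxx.
Qed.

(** The rank of [P] among all subsets makes the radii distinct. The shift by 3 keeps the excess over
    2n + 2 at most 1/3, below the 1/2 by which the sites lie above the line x + y = 2n + 2. *)
Definition radius (R : realType) (n : nat) (P : {set 'I_n}) : R :=
  2 * n%:R + 2 + (enum_rank P + 3)%:R^-1.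

Lemma radius_bound (R : realType) n (P : {set 'I_n}) :
  2 * n%:R + 2 < radius R P <= 2 * n%:R + 2 + 3^-1.
Proof.
rewrite /radius ltrDl invr_gt0 ltr0n addn3 ltn0Sn /= lerD2l lef_pV2 ?posrE//.
by rewrite ler_nat.
Qed.

Lemma radius_inj (R : realType) n : injective (@radius R n).
Proof.
move=> P Q /addrI /invr_inj /eqP; rewrite eqr_nat eqn_add2r.
by move=> /eqP/val_inj/enum_rank_inj.
Qed.

Lemma radius_gt0 (R : realType) n (P : {set 'I_n}) : 0 < radius R P.
Proof.
by have /andP[r _] := radius_bound R P; have := ler0n R n; lra.
Qed.

(** Spike centres lie in [0, 2n - 2], so over a spike the radius exceeds |x| by more than 3, while
    the spike has height at most 1. *)
Lemma bump_spikes (R : realType) n (P : {set 'I_n}) :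
  bump (radius R P) (spikes P).
Proof.
split=> x.
  rewrite /spikes; apply: cvg_big => [|i _]; last exact: tent_continuous.
  by move=> p; apply: cvgD; [exact: cvg_fst|exact: cvg_snd].
rewrite spikes_ge0 /= le_max.
have [/spikes_gt0[i iP ix]|s0] := ltP 0 (spikes P x); last by apply/orP; left.
rewrite (spikesE _ ix) iP mul1r; apply/orP; right.
have := ltn_ord i; rewrite -(ler_nat R) -natr1 => iN.
have := radius_bound R P; move: (ix); rewrite tent_gt0 /tent.
have := ler0n R i => i0 xi rP; rewrite max_r; last lra.
have : `|x| <= `|x - 2 * i%:R| + `|2 * i%:R|.
  by rewrite -{1}(subrK (2 * i%:R) x) ler_normD.
rewrite (ger0_norm (_ : 0 <= 2 * i%:R)); last lra.
have := normr_ge0 (x - 2 * i%:R); lra.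
Qed.

Definition region (R : realType) (n : nat) (P : {set 'I_n}) : set (plane R) :=
  cap (radius R P) (spikes P).

Definition top (R : realType) (n : nat) (P : {set 'I_n}) (x : R) : R :=
  radius R P - `|x| + spikes P x.

Definition site (R : realType) (n : nat) (i : 'I_n) : plane R :=
  (2 * i%:R, 2 * n%:R + 2 + 1 / 2 - 2 * i%:R).

Lemma site_inj (R : realType) n : injective (@site R n).
Proof.
have two0 : (2 : R) != 0 by rewrite pnatr_eq0.
by move=> i j [/(mulfI two0)/eqP]; rewrite eqr_nat => /eqP/val_inj.
Qed.

(** Over x = 2i the upper side has height [radius R P] - 2i, plus 1 exactly when [i] is in [P]; the
    site lies strictly between these two values. *)
Lemma region_site (R : realType) n (P : {set 'I_n}) i :
  region P (site R i) <-> i \in P.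
Proof.
have ti : tent i (2 * i%:R : R) = 1 by rewrite /tent subrr normr0 subr0 max_r.
have i0 := ler0n R i; have := ltn_ord i; rewrite -(ler_nat R) -natr1 => iN.
have := radius_bound R P; have := spikesE P (_ : 0 < tent i (2 * i%:R : R)).
rewrite ti => /(_ ltr01) sE rP; rewrite /region /cap /= sE ger0_norm; last lra.
case: (i \in P); rewrite ?mul1r ?mul0r; split => //; [move=> _; split|case]; lra.
Qed.

Lemma region_inj (R : realType) n : injective (@region R n).
Proof.
move=> P Q PQ; apply/setP => i; apply/idP/idP => /(region_site R).
  by rewrite PQ => /region_site.
by rewrite -PQ => /region_site.
Qed.

(** * Cardinalities and crossings *)

Lemma card_finset (T : finType) (P : {set T}) : [set` P] #= `I_#|P|.
Proof.
rewrite (_ : [set` P] = enum_val @` [set: 'I_#|P|]).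
  rewrite (card_eql (inj_card_eq _)) => [|i j _ _]; last exact: enum_val_inj.
  by rewrite card_eq_sym; exact: card_II.
apply/seteqP; split=> [x /= xP|_ [i _ <-]]; last exact: enum_valP.
by exists (enum_rank_in xP x) => //; rewrite enum_rankK_in.
Qed.

(** The form in which crossings and edges are counted: a finite set of labels and a map that reaches
    every object. *)
Lemma card_le_finset (T : finType) (U : Type) (f : T -> U) (P : {set T})
    (E : set U) (k : nat) :
  E `<=` f @` [set` P] -> (#|P| <= k)%N -> E #<= `I_k.
Proof.
move=> /subset_card_le EP Pk; apply: (card_le_trans EP).
apply: (card_le_trans (card_image_le _ _)).
by rewrite (card_le_eql (card_finset P)) card_le_II.
Qed.

Lemma card_image_finset (T : finType) (U : Type) (f : T -> U) (P : {set T}) :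
  injective f -> f @` [set` P] #= `I_#|P|.
Proof.
move=> fI; rewrite (card_eql (inj_card_eq _)); first exact: card_finset.
by move=> ? ? _ _; exact: fI.
Qed.

Lemma finset_of_image (T : finType) (U : Type) (f : T -> U) (E : set U) :
  E `<=` f @` setT -> exists P : {set T}, E = f @` [set` P].
Proof.
move=> Ef; exists [set x | `[< E (f x) >]]%SET; apply/seteqP.
split=> [u Eu|_ [x + <-]].
  have [x _ xu] := Ef _ Eu; exists x => //=.
  by rewrite inE; apply/asboolP; rewrite xu.
by rewrite /= inE => /asboolP.
Qed.

Lemma boundary_region (R : realType) n (P : {set 'I_n}) (z : plane R) :
  boundary (region P) z <-> `|z.1| <= radius R P /\
    (z.2 = top P z.1 \/ z.2 = `|z.1| - radius R P).
Proof. by rewrite boundary_cap//; exact: bump_spikes. Qed.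

(** The smaller diamond lies strictly inside the larger one, so only upper sides can meet, and there
    a spike of [P] missing from [Q] must make up exactly for the difference of the radii. *)
Lemma boundary_crossing (R : realType) n (P Q : {set 'I_n}) (z : plane R) :
  radius R P < radius R Q -> boundary (region P) z -> boundary (region Q) z ->
  exists i : 'I_n, [/\ i \in P, i \notin Q, z.2 = top P z.1 &
    tent i z.1 = radius R Q - radius R P].
Proof.
case: z => x y rPQ /boundary_region[/= xP yP] /boundary_region[/= xQ yQ].
have := @spikes_ge0 R n P x; have := @spikes_ge0 R n Q x => sQ sP.
have yE : y = top P x by case: yP => [//|yE]; case: yQ; rewrite /top; lra.
have sE : spikes P x - spikes Q x = radius R Q - radius R P.
  by move: yE; case: yQ; rewrite /top; lra.
have [|i [iP iQ ix]] := @spikesB_gt0 R n P Q x; first lra.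
by exists i; split=> //; rewrite -(spikesB iP iQ ix).
Qed.

Lemma card_boundaryI (R : realType) n (P Q : {set 'I_n}) :
  P != Q -> (#|P| <= 2)%N -> (#|Q| <= 2)%N ->
  boundary (@region R n P) `&` boundary (@region R n Q) #<= `I_4.
Proof.
wlog rPQ : P Q / radius R P <= radius R Q => [wlogPQ PQ P2 Q2|].
  have [r|/ltW r] := leP (radius R P) (radius R Q); first exact: wlogPQ.
  by rewrite setIC; apply: wlogPQ => //; rewrite eq_sym.
move=> PQ P2 Q2.
have {}rPQ : radius R P < radius R Q.
  by rewrite lt_neqAle rPQ andbT; apply: contra PQ => /eqP/radius_inj->.
(* [d] is the distance from the centre of a spike at which its height equals the difference of the
   radii; the boolean in [f] chooses the flank. *)
pose d := 1 - (radius R Q - radius R P).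
pose f (t : 'I_n * bool) : plane R :=
  let x := 2 * t.1%:R + (if t.2 then d else - d) in (x, top P x).
apply: (@card_le_finset _ _ f (finset.setX P [set: bool]%SET)).
  move=> [x y] [zP zQ].
  have [i [iP iQ /= -> /tent_eq]] := boundary_crossing rPQ zP zQ.
  rewrite subr_gt0 => /(_ rPQ) [xE|xE].
    by exists (i, true); rewrite /= ?inE ?iP//= /f /= -/d -xE.
  by exists (i, false); rewrite /= ?inE ?iP//= /f /= -/d -xE.
by rewrite cardsX cardsT card_bool (leq_mul P2 (leqnn 2)).
Qed.

(** * Edges of the union *)

Lemma arrangement_verticesP (R : realType) n (F : {set {set 'I_n}}) (z : plane R) :
  arrangement_vertices (@region R n @` [set` F]) z <->
  exists P Q, [/\ P \in F, Q \in F, P != Q,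
    boundary (region P) z & boundary (region Q) z].
Proof.
split=> [[_ [_ [[P PF <-] [Q QF <-] PQ [zP zQ]]]]|[P [Q [PF QF PQ zP zQ]]]].
  by exists P, Q; split=> //; apply/eqP => e; apply: PQ; rewrite e.
exists (region P), (region Q); split=> //.
by move=> /region_inj e; rewrite e eqxx in PQ.
Qed.

(** The edges of the arrangement are the connected components of these sets, for [P] in [F]. *)
Definition free_boundary (R : realType) n (F : {set {set 'I_n}}) (P : {set 'I_n}) :
    set (plane R) :=
  boundary (region P) `\` arrangement_vertices (@region R n @` [set` F]).

Lemma free_boundaryP (R : realType) n (F : {set {set 'I_n}}) (P : {set 'I_n})
    (z : plane R) :
  boundary (region P) z ->
  (forall Q, Q \in F -> Q != P -> ~ boundary (region Q) z) ->
  free_boundary F P z.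
Proof.
move=> zP zF; split=> // /arrangement_verticesP[A [B [AF BF AB zA zB]]].
have [AP|AP] := eqVneq A P; last exact: (zF A).
by apply: (zF B) => //; rewrite -AP eq_sym.
Qed.

(** Comparing with every [Q] is harmless beyond the ends of [region Q], since [top Q] is negative
    there. *)
Definition dominates (R : realType) n (F : {set {set 'I_n}}) (P : {set 'I_n})
    (x : R) : Prop :=
  `|x| <= radius R P /\ forall Q, Q \in F -> Q != P -> top Q x < top P x.

Lemma dominates_free (R : realType) n (F : {set {set 'I_n}}) P (x : R) :
  dominates F P x -> free_boundary F P (x, top P x).
Proof.
move=> [xP QP]; apply: free_boundaryP.
  by apply/boundary_region; split=> //; left.
move=> Q QF QneP /boundary_region[/= xQ yQ]; have := QP _ QF QneP.
by have := spikes_ge0 Q x; case: yQ => [->|]; rewrite /top; lra.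
Qed.

Definition leader (R : realType) n (F : {set {set 'I_n}}) (M : {set 'I_n}) : Prop :=
  M \in F /\ forall Q, Q \in F -> Q != M -> radius R Q < radius R M.

(** The lower side of the largest diamond lies strictly below all other regions. *)
Lemma bottom_free (R : realType) n (F : {set {set 'I_n}}) M (x : R) :
  leader R F M -> `|x| <= radius R M -> free_boundary F M (x, `|x| - radius R M).
Proof.
move=> [_ lM] xM; apply: free_boundaryP.
  by apply/boundary_region; split=> //; right.
move=> Q QF QneM /boundary_region[/= xQ yQ]; have := lM _ QF QneM.
by have := spikes_ge0 Q x; case: yQ; rewrite /top; lra.
Qed.

(** If another region reached as far as [z], then [z] would be a vertex in case of a tie, and
    otherwise an interior point of that region and hence of the union. *)
Lemma outer_free_boundary (R : realType) n (F : {set {set 'I_n}}) P (z : plane R) :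
  P \in F -> free_boundary F P z ->
  boundary (\bigcup_(A in @region R n @` [set` F]) A) z ->
  (z.2 = top P z.1 /\ dominates F P z.1) \/
  (z.2 = `|z.1| - radius R P /\ leader R F P).
Proof.
case: z => x y PF [zP zV] [_ zint].
have zF Q : Q \in F -> ~ (`|x| - radius R Q < y /\ y < top Q x).
  move=> QF zQ; apply: zint; apply: (@interiorS _ (region Q)).
    by move=> w wQ; exists (region Q) => //; exists Q.
  by rewrite interior_cap; last exact: bump_spikes.
have tieF Q : Q \in F -> Q != P -> `|x| <= radius R Q -> y = top Q x -> False.
  move=> QF QP xQ yQ; apply: zV; apply/arrangement_verticesP.
  exists Q, P; split=> //.
  by apply/boundary_region; split=> //; left.
have /boundary_region[/= xP yP] := zP.
have sP := spikes_ge0 P x.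
case: yP => yP; [left|right]; split=> //; split=> // Q QF QP.
  have [xQ|Qx] := leP `|x| (radius R Q); last first.
    by rewrite /top (bump_eq0 (bump_spikes R Q) (ltW Qx)); lra.
  rewrite lt_neqAle; apply/andP; split.
    by apply/eqP => e; apply: (tieF _ QF QP xQ); rewrite yP.
  rewrite leNgt; apply/negP => PQ; have sQ := spikes_ge0 Q x.
  (* At its two ends [region Q] shrinks to a point of height 0, so it cannot rise above the upper
     side of [P] there. *)
  have [Qx|Qx] := eqVneq `|x| (radius R Q).
    have sQ0 : spikes Q x = 0 by apply: (bump_eq0 (bump_spikes R Q)); rewrite Qx.
    by move: PQ; rewrite /top; lra.
  apply: (zF _ QF); rewrite yP; split=> //.
  have {}Qx : `|x| < radius R Q by rewrite lt_neqAle Qx.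
  by rewrite /top; lra.
rewrite lt_neqAle; apply/andP; split.
  by apply: contra QP => /eqP/radius_inj->.
rewrite leNgt; apply/negP => PQ; apply: (zF _ QF).
by have := spikes_ge0 Q x; rewrite /top; split; lra.
Qed.

(** * Joining boundary points along graphs *)

Lemma graph_connected (R : realType) (f : R -> R) (a b : R) :
  continuous f -> connected ((fun x => (x, f x)) @` `[a, b]).
Proof.
move=> fc; apply: connected_continuous_connected; first exact: segment_connected.
apply: continuous_subspaceT => x.
apply: (@cvg_pair _ _ _ (nbhs x) (nbhs x) (nbhs (f x))); first exact: cvg_id.
exact: fc.
Qed.

Lemma graph_connected_component (R : realType) (f : R -> R) (A : set (plane R))
    (a b x y : R) :
  continuous f -> (forall t, a <= t <= b -> A (t, f t)) ->
  a <= x <= b -> a <= y <= b -> connected_component A (x, f x) (y, f y).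
Proof.
move=> fc fA xab yab.
apply: (connected_component_max (B := (fun x => (x, f x)) @` `[a, b])).
- by exists x => //; rewrite /= in_itv.
- by move=> _ [t tab <-]; apply: fA; move: tab; rewrite /= in_itv.
- exact: graph_connected.
- by exists y => //; rewrite /= in_itv.
Qed.

Lemma top_continuous (R : realType) n (P : {set 'I_n}) : continuous (@top R n P).
Proof.
have [sc _] := bump_spikes R P.
move=> x; apply: cvgD; last exact: sc.
by apply: cvgB; [exact: cvg_cst|apply: cvg_norm; exact: cvg_id].
Qed.

Lemma dominates_connected (R : realType) n (F : {set {set 'I_n}}) P (a b x y : R) :
  (forall t, a <= t <= b -> dominates F P t) -> a <= x <= b -> a <= y <= b ->
  connected_component (free_boundary F P) (x, top P x) (y, top P y).
Proof.
move=> abF; apply: graph_connected_component; first exact: top_continuous.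
by move=> t /abF /dominates_free.
Qed.

Lemma bottom_connected (R : realType) n (F : {set {set 'I_n}}) M (x y : R) :
  leader R F M -> `|x| <= radius R M -> `|y| <= radius R M ->
  connected_component (free_boundary F M)
    (x, `|x| - radius R M) (y, `|y| - radius R M).
Proof.
move=> lM; rewrite !ler_norml => xM yM.
apply: (@graph_connected_component _ (fun x => `|x| - radius R M)) xM yM.
  by move=> t; apply: cvgB; [apply: cvg_norm; exact: cvg_id|exact: cvg_cst].
by move=> t; rewrite -ler_norml; exact: bottom_free.
Qed.

Lemma top_edge (R : realType) n (P : {set 'I_n}) (x : R) :
  `|x| = radius R P -> top P x = `|x| - radius R P.
Proof.
move=> xP; rewrite /top (bump_eq0 (bump_spikes R P)) xP ?lexx//.
by rewrite subrr addr0.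
Qed.

(** [P] can rise above [M] only on a spike that [M] lacks. Climbing from [x] to the peak of this
    spike only strengthens the position of [P], so the whole way stays on one edge. *)
Lemma peak_connected (R : realType) n (F : {set {set 'I_n}}) M P (x : R) :
  leader R F M -> P \in F -> P != M -> dominates F P x ->
  exists2 i : 'I_n, i \in P &
    connected_component (free_boundary F P)
      (x, top P x) (2 * i%:R, top P (2 * i%:R)).
Proof.
move=> [MF lM] PF PM [xP domx]; have rPM := lM _ PF PM.
have topMP : top M x < top P x by apply: domx => //; rewrite eq_sym.
have [|i [iP iM ix]] := @spikesB_gt0 R n P M x.
  by move: topMP; rewrite /top; lra.
have tix : radius R M - radius R P < tent i x.
  by rewrite -(spikesB iP iM ix); move: topMP; rewrite /top; lra.
exists i => //; set a : R := 2 * i%:R.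
have i0 : 0 <= i%:R :> R := ler0n R i.
have iN : i%:R + 1 <= n%:R :> R by rewrite natr1 ler_nat.
have /andP[rP _] := radius_bound R P.
suff dom t : Num.min x a <= t <= Num.max x a -> dominates F P t.
  by apply: (dominates_connected dom); rewrite ge_min le_max lexx ?orbT.
move=> xat.
have tx : `|t - a| <= `|x - a|.
  move: xat; rewrite ge_min le_max => /andP[/orP[] ta /orP[] at'];
    case: (ger0P (x - a)); case: (ger0P (t - a)); lra.
have tit : tent i x <= tent i t by exact: tent_mono.
split.
  move: xP xat; rewrite !ler_norml ge_min le_max => xP /andP[/orP[] ta /orP[] at'];
    move: ta at'; rewrite /a; lra.
move=> Q QF QP; have it : 0 < tent i t by apply: lt_le_trans tit.
(* If [Q] also carries spike [i], the difference of the tops is the same at [x] and at [t]; if not,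
   it changes in favour of [P] as the spike grows. *)
have := domx _ QF QP; rewrite /top !(spikesE _ ix) !(spikesE _ it) iP.
have rQM : radius R Q <= radius R M.
  by have [->//|QM] := eqVneq Q M; exact/ltW/lM.
by case: (i \in Q); rewrite /= ?mul1r ?mul0r; lra.
Qed.

(** Only on such a spike can another region rise above the upper side of the leader [M]. *)
Definition rival n (F : {set {set 'I_n}}) (M : {set 'I_n}) (i : 'I_n) : bool :=
  [exists Q in F, (Q != M) && (i \in Q :\: M)].

(** Off the spikes missing from [M] the larger radius decides. On such a spike [j] of [Q], the tops
    differ by [tent j x] minus the difference of the radii. *)
Lemma leader_dominatesP (R : realType) n (F : {set {set 'I_n}}) M (x : R) :
  leader R F M -> `|x| <= radius R M ->
  dominates F M x <->
  forall Q (j : 'I_n), Q \in F -> Q != M -> j \in Q :\: M ->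
    tent j x < radius R M - radius R Q.
Proof.
move=> [MF lM] xM; split=> [[_ domx] Q j QF QM|tx].
  rewrite inE => /andP[jM jQ]; have := domx _ QF QM; rewrite /top.
  have [jx|jx] := ltP 0 (tent j x); first by have := spikesB jQ jM jx; lra.
  by have := lM _ QF QM; lra.
split=> // Q QF QM; rewrite ltNge; apply/negP => MQ; have rQM := lM _ QF QM.
have [|j [jQ jM jx]] := @spikesB_gt0 R n Q M x; first by move: MQ; rewrite /top; lra.
have := tx Q j QF QM; rewrite inE jM jQ => /(_ isT); rewrite -(spikesB jQ jM jx).
by move: MQ; rewrite /top; lra.
Qed.

Lemma rivalI n (F : {set {set 'I_n}}) M Q (j : 'I_n) :
  Q \in F -> Q != M -> j \in Q :\: M -> rival F M j.
Proof. by move=> QF QM jQ; apply/exists_inP; exists Q => //; rewrite QM. Qed.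

(** The right foot 2i + 1 of spike [i], where all tents vanish, will mark the edge of [M] that
    follows this spike. *)
Lemma valley_end_norm (R : realType) n (M : {set 'I_n}) (i : 'I_n) :
  `|2 * i%:R + 1| <= radius R M.
Proof.
have i0 : 0 <= i%:R :> R := ler0n R i.
have iN : i%:R + 1 <= n%:R :> R by rewrite natr1 ler_nat.
by have /andP[rM _] := radius_bound R M; rewrite ger0_norm; lra.
Qed.

(** Between [x] and the foot of spike [i], tents left of [i] vanish; tent [i] and the rival tents
    right of [x] are either zero or no higher than at [x]. Hence [M] keeps dominating. *)
Lemma valley_connected (R : realType) n (F : {set {set 'I_n}}) M (x : R) (i : 'I_n) :
  leader R F M -> dominates F M x -> 2 * i%:R <= x ->
  (forall j : 'I_n, rival F M j -> (j <= i)%N \/ x < 2 * j%:R) ->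
  connected_component (free_boundary F M)
    (x, top M x) (2 * i%:R + 1, top M (2 * i%:R + 1)).
Proof.
move=> lM domx ix jx; have [xM _] := domx; set b : R := 2 * i%:R + 1.
suff dom t : Num.min x b <= t <= Num.max x b -> dominates F M t.
  by apply: (dominates_connected dom); rewrite ge_min le_max lexx ?orbT.
rewrite ge_min le_max => /andP[tl tr].
have bM := valley_end_norm R M i; rewrite -/b in bM.
have tM : `|t| <= radius R M.
  move: xM bM; rewrite !ler_norml.
  by case/orP: tl => tl; case/orP: tr => tr; lra.
apply/leader_dominatesP => // Q j QF QM jQM.
have := (leader_dominatesP lM xM).1 domx Q j QF QM jQM; apply: le_lt_trans.
have [ji|ij|/val_inj ->] := ltngtP j i.
- rewrite tent_eq0 ?tent_ge0//.
  have ji1 : j%:R + 1 <= i%:R :> R by rewrite natr1 ler_nat.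
  rewrite ger0_norm; case/orP: tl; rewrite /b; lra.
- have {jx} [|jx] := jx j (rivalI QF QM jQM); first by rewrite leqNgt ij.
  have {}ij : i%:R + 1 <= j%:R :> R by rewrite natr1 ler_nat.
  case/orP: tr => tr; last first.
    by rewrite tent_eq0 ?tent_ge0// ler0_norm; move: tr; rewrite /b; lra.
  by apply: tent_mono; rewrite !ler0_norm; lra.
case/orP: tl => tl; last first.
  by rewrite tent_eq0 ?tent_ge0// ger0_norm; move: tl; rewrite /b; lra.
by apply: tent_mono; rewrite !ger0_norm; lra.
Qed.

(** Right of the foot of the last rival spike nothing interrupts [M], so its upper side leads to the
    right corner, where the lower side begins. *)
Lemma wrap_connected (R : realType) n (F : {set {set 'I_n}}) M (x : R) (i : 'I_n) :
  leader R F M -> `|x| <= radius R M -> (forall j, rival F M j -> (j <= i)%N) ->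
  connected_component (free_boundary F M)
    (x, `|x| - radius R M) (2 * i%:R + 1, top M (2 * i%:R + 1)).
Proof.
move=> lM xM ji; have r0 := radius_gt0 R M.
have rM : `|radius R M| = radius R M by rewrite gtr0_norm.
apply: (connected_component_trans (bottom_connected lM xM (_ : `|radius R M| <= _))).
  by rewrite rM.
rewrite -top_edge//.
have := valley_end_norm R M i; rewrite ler_norml => /andP[bM Mb].
apply: (@dominates_connected _ _ _ _ (2 * i%:R + 1) (radius R M));
  rewrite ?lexx ?Mb//.
move=> t /andP[bt tM].
have {}tM : `|t| <= radius R M by rewrite ler_norml; lra.
apply/leader_dominatesP => // Q j QF QM jQM.
rewrite tent_eq0 ?subr_gt0; first by case: lM => _; apply.
have ji1 : j%:R <= i%:R :> R by rewrite ler_nat; apply: ji; exact: rivalI jQM.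
by rewrite ger0_norm; lra.
Qed.

(** Moving left from [x] leads away from all rival spikes, so [M] dominates as far as its left
    corner. *)
Lemma left_connected (R : realType) n (F : {set {set 'I_n}}) M (x : R) :
  leader R F M -> dominates F M x ->
  (forall j : 'I_n, rival F M j -> x < 2 * j%:R) ->
  connected_component (free_boundary F M)
    (x, top M x) (- radius R M, `|- radius R M| - radius R M).
Proof.
move=> lM domx xj; have [xM _] := domx.
have rM : `|- radius R M| = radius R M by rewrite normrN gtr0_norm ?radius_gt0.
rewrite -top_edge//; move: (xM); rewrite ler_norml => /andP[Mx _].
apply: (@dominates_connected _ _ _ _ (- radius R M) x); rewrite ?lexx ?Mx//.
move=> t /andP[Mt tx].
have tM : `|t| <= radius R M by move: xM; rewrite !ler_norml; lra.
apply/leader_dominatesP => // Q j QF QM jQM.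
have := (leader_dominatesP lM xM).1 domx Q j QF QM jQM; apply: le_lt_trans.
have {}xj := xj j (rivalI QF QM jQM).
by apply: tent_mono; rewrite !ler0_norm; lra.
Qed.

(* Walking left from z, and through the lower side if needed, i is the first
   rival spike met. *)
Lemma leader_connected (R : realType) n (F : {set {set 'I_n}}) M (i0 : 'I_n)
    (z : plane R) :
  leader R F M -> rival F M i0 -> `|z.1| <= radius R M ->
  (z.2 = top M z.1 /\ dominates F M z.1) \/ z.2 = `|z.1| - radius R M ->
  exists2 i, rival F M i & connected_component (free_boundary F M)
    z (2 * i%:R + 1, top M (2 * i%:R + 1)).
Proof.
case: z => x y /= lM i0F xM zE.
have last : exists2 i, rival F M i & forall j, rival F M j -> (j <= i)%N.
  by case: (arg_maxnP (fun i : 'I_n => i : nat) i0F) => i iF ji; exists i.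
case: zE => [[-> domx]|->]; last first.
  by case: last => i iF ji; exists i => //; exact: wrap_connected.
have [/existsP[j0 j0P]|] :=
    boolP [exists j : 'I_n, rival F M j && (2 * j%:R <= x)].
  case: (arg_maxnP (P := fun j : 'I_n => rival F M j && (2 * j%:R <= x))
    (fun i : 'I_n => i : nat) j0P) => i /andP[iF ix] ji.
  exists i => //; apply: valley_connected => // j jF.
  by have [jx|] := leP (2 * j%:R) x; [left; apply: ji; rewrite jF|right].
rewrite negb_exists => /forallP nx.
case: last => i iF ji; exists i => //.
apply: (connected_component_trans (left_connected lM domx _)).
  by move=> j jF; have := nx j; rewrite jF -ltNge.
by apply: wrap_connected => //; rewrite normrN gtr0_norm ?radius_gt0.
Qed.

Lemma leader_exists (R : realType) n (F : {set {set 'I_n}}) :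
  F != finset.set0 -> exists M, leader R F M.
Proof.
case/set0Pn => P PF.
case: (Order.TotalTheory.arg_maxP (fun Q => radius R Q) PF) => M MF maxM.
exists M; split=> // Q QF QM.
rewrite lt_neqAle; apply/andP; split; last exact: maxM.
by apply: contra QM => /eqP/radius_inj->.
Qed.

Lemma card_setX_in (T U : finType) (A : {set T}) (B : T -> {set U}) (k : nat) :
  (forall x, x \in A -> #|B x| <= k)%N ->
  (#|[set t : T * U | (t.1 \in A) && (t.2 \in B t.1)]%SET| <= #|A| * k)%N.
Proof.
move=> Bk; rewrite cardsE -sum1_card.
rewrite -(pair_big_dep (mem A) (fun x y => y \in B x) (fun _ _ => 1%N))/=.
rewrite -sum_nat_const; apply: leq_sum => x xA; rewrite sum1_card; exact: Bk.
Qed.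

Lemma card_union_edges (R : realType) n (F : {set {set 'I_n}}) :
  (1 < #|F|)%N -> (forall P, P \in F -> #|P| = 2) ->
  union_complexity_le (@region R n @` [set` F]) (4 * #|F| - 4).
Proof.
move=> F1 F2; have [|M lM] := @leader_exists R n F.
  by rewrite -card_gt0; apply: leq_trans F1.
have [MF rM] := lM.
have cF : #|(F :\ M)%SET| = #|F|.-1 by rewrite (cardsD1 M F) MF.
(* Two distinct sets of size two are not contained in each other, so any second member of [F] has a
   spike that [M] lacks. *)
have [i0 i0F] : exists i, rival F M i.
  have /card_gt0P[Q] : (0 < #|(F :\ M)%SET|)%N by rewrite cF -ltnS prednK // ltnW.
  rewrite !inE => /andP[QM QF].
  have /set0Pn[i iQM] : (Q :\: M)%SET != finset.set0.
    rewrite finset.setD_eq0; apply: contra QM => QM.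
    by rewrite eqEcard QM !F2.
  by exists i; exact: rivalI iQM.
(* A label is a spike of a region other than [M] with a boolean: [false] stands for the edge through
   its peak, [true] for the edge of [M] through its right foot. *)
pose f (t : ({set 'I_n} * 'I_n) * bool) : set (plane R) :=
  let x := 2 * t.1.2%:R in
  if t.2 then connected_component (free_boundary F M) (x + 1, top M (x + 1))
  else connected_component (free_boundary F t.1.1) (x, top t.1.1 x).
pose I := [set t : {set 'I_n} * 'I_n | (t.1 \in (F :\ M)%SET) && (t.2 \in t.1)]%SET.
apply: (@card_le_finset _ _ f (finset.setX I [set: bool]%SET)).
  move=> _ [[_ [z [[P PF <-] zP ->]]] Eb].
  have {}Eb := Eb z (connected_component_refl zP).
  have oz := outer_free_boundary PF zP Eb.
  have [PM|PM] := eqVneq P M.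
    rewrite {}PM in PF zP oz *.
    have [zM _] := (boundary_region _ _).1 zP.1.
    have [|i /exists_inP[Q QF /andP[QM iQM]] zi] := leader_connected lM i0F zM.
      by case: oz => [|[]]; [left|right].
    exists (Q, i, true); last exact/esym/same_connected_component.
    by move: iQM; rewrite /= finset.in_setX !inE /= QM QF => /andP[_ ->].
  case: oz => [[zE domz]|[_ [_ lP]]]; last first.
    (* An outer point on the lower side would make [P] a second leader. *)
    by have := rM _ PF PM; rewrite ltNge ltW// lP// eq_sym.
  have [i iP] := peak_connected lM PF PM domz.
  rewrite -zE -surjective_pairing => zi.
  exists (P, i, false); last exact/esym/same_connected_component.
  by rewrite /= finset.in_setX !inE /= PM PF iP.
rewrite cardsX cardsT card_bool.
have : (#|I| <= #|(F :\ M)%SET| * 2)%N.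
  apply: (card_setX_in (B := id)) => P; rewrite !inE => /andP[_ PF].
  by rewrite F2.
by rewrite cF; lia.
Qed.

(** A single region has no vertices and its boundary is one closed edge. The bound 4m - 4 would be 0
    there, so linear complexity needs this case separately. *)
Lemma card_union_edges_le1 (R : realType) n (F : {set {set 'I_n}}) :
  (#|F| <= 1)%N -> union_complexity_le (@region R n @` [set` F]) #|F|.
Proof.
move=> F1; have noV : arrangement_vertices (@region R n @` [set` F]) = set0.
  rewrite -subset0 => z /arrangement_verticesP[P [Q [PF QF + _ _]]].
  by rewrite (card_le1_eqP F1 P Q PF QF) eqxx.
apply: (@card_le_finset _ _ (fun P => boundary (@region R n P)) F) => //.
move=> _ [[_ [z [[P PF <-] zP ->]]] _]; exists P => //.
move: zP; rewrite noV setD0 => zP; apply/esym/connected_component_id => //.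
by apply: connected_boundary_cap; [exact: bump_spikes|exact: radius_gt0].
Qed.

(** * Subfamilies, hyperedges and the final assembly *)

Lemma subfamily_finset (R : realType) n (F : {set {set 'I_n}})
    (G : set (set (plane R))) (m : nat) :
  G `<=` @region R n @` [set` F] -> G #= `I_m ->
  exists F' : {set {set 'I_n}},
    [/\ F' \subset F, #|F'| = m & G = @region R n @` [set` F']].
Proof.
move=> GF Gm.
have [F' GE] : exists F' : {set {set 'I_n}}, G = @region R n @` [set` F'].
  by apply: finset_of_image => A /GF[P _ <-]; exists P.
exists F'; split=> //.
  apply/fintype.subsetP => P PF'.
  have [|Q QF QP] := GF (region P); first by rewrite GE; exists P.
  by rewrite -(region_inj QP).
apply/card_eq_II; have := card_image_finset F' (@region_inj R n).
by rewrite -GE card_eq_sym => FG; exact: card_eq_trans FG Gm.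
Qed.

Lemma hyperedge_region (R : realType) n (P : {set 'I_n}) :
  range (@site R n) `&` region P = @site R n @` [set` P].
Proof.
apply/seteqP; split=> [_ [[i _ <-] /region_site iP]|_ [i iP <-]]; first by exists i.
by split; [exists i|exact/region_site].
Qed.

Theorem claim46 (R : realType) (n : nat) :
  exists (S : set (plane R)) (F : set (set (plane R))),
    S #= `I_n /\
    F #= `I_'C(n, 2) /\
    (forall A, F A -> Jordan_region A) /\
    linear_union_complexity F /\
    is_complete_graph n (intersection_hypergraph S F) /\
    (forall p q, S p -> S q -> p <> q ->
       exists2 A, F A & S `&` A = [set p; q]) /\
    (forall A B, F A -> F B -> A <> B ->
       boundary A `&` boundary B #<= `I_4) /\
    (forall (m : nat) (G : set (set (plane R))),
       (1 < m)%N -> G `<=` F -> G #= `I_m ->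
       union_complexity_le G (4 * m - 4)).
Proof.
pose F2 := [set P : {set 'I_n} | #|P| == 2]%SET.
have F2P (P : {set 'I_n}) : P \in F2 -> #|P| = 2 by rewrite inE => /eqP.
have cS : range (@site R n) #= `I_n.
  rewrite (card_eql (inj_card_eq _)) => [|? ? _ _]; last exact: site_inj.
  by rewrite card_eq_sym; exact: card_II.
have bound m (G : set (set (plane R))) :
    (1 < m)%N -> G `<=` @region R n @` [set` F2] -> G #= `I_m ->
    union_complexity_le G (4 * m - 4).
  move=> m1 GF Gm; have [F' [/fintype.subsetP F'F cF' ->]] := subfamily_finset GF Gm.
  rewrite -cF' in m1 *; apply: card_union_edges => // P /F'F; exact: F2P.
exists (range (@site R n)), (@region R n @` [set` F2]); split=> //.
split.
  have := card_image_finset F2 (@region_inj R n).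
  by rewrite card_draws card_ord.
split.
  move=> _ [P _ <-]; apply: Jordan_region_cap; first exact: bump_spikes.
  exact: radius_gt0.
split.
  (* For m >= 2 the constant 4 comes from 4m - 4; for smaller [m] there are at most [m] edges. *)
  exists 4 => m G GF Gm; have [m1|m1] := ltnP 1 m.
    apply: card_le_trans (bound m G m1 GF Gm) _.
    by rewrite card_le_II leq_subr.
  have [F' [_ cF' ->]] := subfamily_finset GF Gm.
  have F'1 : (#|F'| <= 1)%N by rewrite cF'.
  apply: card_le_trans (card_union_edges_le1 R F'1) _.
  by rewrite card_le_II cF' leq_pmull.
split.
  split=> //=; apply/seteqP; split=> [e [[_ [P PF <-] ->] _]|e [eS e2]] /=.
    rewrite hyperedge_region; split; first by move=> _ [i _ <-]; exists i.
    have := card_image_finset P (@site_inj R n); by rewrite (F2P P PF).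
  (* A two-point subset of the sites comes from a two-element index set [P], and [region P] cuts out
     exactly that subset. *)
  have [P eP] := finset_of_image eS.
  have P2 : #|P| = 2.
    apply/card_eq_II; have := card_image_finset P (@site_inj R n).
    by rewrite -eP card_eq_sym => Pe; exact: card_eq_trans Pe e2.
  split; last by move: e2; rewrite card_eq_le => /andP[].
  exists (region P); last by rewrite hyperedge_region.
  by exists P => //=; rewrite inE P2.
split.
  move=> _ _ [i _ <-] [j _ <-] ij; exists (region [set i; j]%SET).
    exists [set i; j]%SET => //=; rewrite inE cards2.
    suff -> : i != j by [].
    by apply/eqP => e; apply: ij; rewrite e.
  rewrite hyperedge_region; apply/seteqP; split=> [_ [k /= + <-]|_ [->|->]].
  - by rewrite !inE => /orP[/eqP->|/eqP->]; [left|right].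
  - by exists i => //=; rewrite !inE eqxx.
  - by exists j => //=; rewrite !inE eqxx orbT.
split=> //.
move=> _ _ [P /F2P P2 <-] [Q /F2P Q2 <-] PQ.
apply: card_boundaryI; rewrite ?P2 ?Q2//.
by apply/eqP => e; apply: PQ; rewrite e.
Qed.
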